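(* Let $k$ be an algebraically closed field, let $X$ be a variety over $k$, and let $f: X\dashrightarrow X$ be a dominant rational self-map. Let $x_n\in X(k)$, $n\leq 0$, be a sequence of points, each with well-defined $f$-orbit, such that $\{x_n\mid n\leq 0\}$ is Zariski dense in $X$ and $f(x_n)=x_{n+1}$ for all $n\leq -1$. Let $V$ be a proper subvariety of $X$. Then $\{n\leq 0\mid x_n\in V\}$ is of Banach density zero in $\mathbb{Z}_{\leq 0}$.
   Context: A variety is an irreducible, reduced, separated scheme of finite type over a field; a subvariety of $X$ is a Zariski closed subset of $X$. The $f$-orbit of $x$ is well defined if $f^n(x)$ is not in the indeterminacy locus of $f$ for all $n\ge 0$. A subset $S\subseteq\mathbb{Z}_{\le 0}$ is of Banach density zero in $\mathbb{Z}_{\le 0}$ if for every sequence of (finite, nonempty) intervals $I_n$, $n\ge0$, in $\mathbb{Z}_{\le 0}$ with $\lim_{n\to\infty}\#I_n=+\infty$ one has $\lim_{n\to\infty}\#(S\cap I_n)/\#I_n=0$. *)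

(* Defs.v *)
From HB Require Import structures.
From mathcomp Require Import all_boot all_order all_algebra finmap.
From mathcomp Require Import all_classical all_reals all_analysis.

Set Implicit Arguments.
Unset Strict Implicit.
Unset Printing Implicit Defensive.

Import Order.TTheory GRing.Theory Num.Theory.
Import numFieldNormedType.Exports.

Local Open Scope classical_set_scope.
Local Open Scope ring_scope.

(** * Commutative algebra

    Rings are [comPzRingType]s: the zero ring must be allowed, since it is the
    ring of sections over the empty set. *)

Definition is_rmorphism (A B : comPzRingType) (f : A -> B) : Prop :=
  zmod_morphism f /\ monoid_morphism f.

Definition is_unit (A : comPzRingType) (a : A) : Prop := exists b, b * a = 1.

Record prime_spectrum (A : comPzRingType) := PrimeIdeal {
  prime_set : set A;
  prime0 : prime_set 0;
  primeD : forall a b, prime_set a -> prime_set b -> prime_set (a + b);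
  primeM : forall a b, prime_set b -> prime_set (a * b);
  prime1 : ~ prime_set 1;
  primeP : forall a b, prime_set (a * b) -> prime_set a \/ prime_set b
}.

Definition zariski_open (A : comPzRingType) (D : set (prime_spectrum A)) :=
  exists E : set A, D = [set p : prime_spectrum A | ~ (E `<=` prime_set p)].

(** [f : A -> B] exhibits [B] as the localization A_a of [A] at the powers
    of [a]. *)
Definition is_localization (A B : comPzRingType) (a : A) (f : A -> B) : Prop :=
  [/\ is_rmorphism f,
      is_unit (f a),
      forall s : B, exists b n, s * f a ^+ n = f b &
      forall b, f b = 0 -> exists n, a ^+ n * b = 0].

(** [A] is finitely generated as an algebra over [k] via [i : k -> A]. *)
Definition fin_gen_algebra (k A : comPzRingType) (i : k -> A) : Prop :=
  exists gens : seq A, forall S : set A,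
    (forall c, S (i c)) -> (forall g, g \in gens -> S g) ->
    (forall a b, S a -> S b -> S (a + b)) ->
    (forall a b, S a -> S b -> S (a * b)) ->
    S = setT.

(** * Spaces with a sheaf of k-algebras

    [sec U] is the ring of sections over [U] and [res U V] is the restriction
    map. Both are total in [U] and [V] but only meaningful for open sets with
    [V `<=` U]; no axiom constrains the other values. The k-structure is given
    by [const : k -> sec setT], i.e. by a morphism to Spec k. *)
Record kspace (k : fieldType) := KSpace {
  pt :> topologicalType;
  sec : set pt -> comPzRingType;
  res : forall U V : set pt, sec U -> sec V;
  const : k -> sec setT;
  res_rmorphism : forall U V, open U -> open V -> V `<=` U ->
    is_rmorphism (@res U V);
  res_id : forall U (s : sec U), open U -> res U s = s;
  res_comp : forall U V W (s : sec U), open U -> open V -> open W ->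
    V `<=` U -> W `<=` V -> res W (res V s) = res W s;
  sheafP : forall (C : set (set pt)) (s : forall U, sec U),
    C `<=` open ->
    (forall U V, C U -> C V ->
       res (U `&` V) (s U) = res (U `&` V) (s V)) ->
    exists! t : sec (\bigcup_(U in C) U), forall U, C U -> res U t = s U;
  const_rmorphism : is_rmorphism const
}.

Arguments sec {k} X U : rename.
Arguments res {k X U} V s : rename.
Arguments const {k} X c : rename.

Section Spaces.
Variable k : fieldType.
Implicit Types X Y Z : kspace k.

Definition constant X (U : set X) (c : k) : sec X U := res U (const X c).

(** The germ of [s] at [x] is a unit of the stalk at [x]; when the stalk is
    local, its maximal ideal consists of the germs for which this fails. *)
Definition germ_unit X (U : set X) (s : sec X U) (x : X) : Prop :=
  exists W : set X, [/\ open W, W x, W `<=` U & is_unit (res W s)].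

(** The open subspace [U] is isomorphic to the spectrum of [A]: [h] is the
    homeomorphism, [phi] the isomorphism on global sections, and the structure
    sheaf of Spec A is characterized as the sheaf whose sections over the
    principal open set D(a) are A_a, with restrictions the localization maps.
    An isomorphism of ringed spaces preserves stalks, hence is local. *)
Definition is_spec X (U : set X) (A : comPzRingType)
    (h : X -> prime_spectrum A) (phi : A -> sec X U) : Prop :=
  [/\ open U,
      set_bij U setT h,
      forall W : set X, W `<=` U -> (open W <-> zariski_open (h @` W)) &
      forall a : A, is_localization a
        (fun b => res (U `&` [set x | ~ prime_set (h x) a]) (phi b))].

Definition affine_open X (U : set X) : Prop :=
  exists (A : comPzRingType) (h : X -> prime_spectrum A) (phi : A -> sec X U),
    is_spec h phi.

Definition is_scheme X : Prop :=
  forall x : X, exists U : set X, affine_open U /\ U x.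

Definition finite_type X : Prop :=
  exists C : set (set X),
    [/\ finite_set C, \bigcup_(U in C) U = setT &
        forall U, C U -> affine_open U /\ fin_gen_algebra (@constant X U)].

Definition reduced X : Prop :=
  forall (U : set X) (s : sec X U) n, open U -> s ^+ n = 0 -> s = 0.

Definition irreducible (T : topologicalType) : Prop :=
  [set: T] !=set0 /\
  forall A B : set T, closed A -> closed B -> A `|` B = setT ->
    A = setT \/ B = setT.

(** Morphisms over k, as locally ringed spaces, from the open subspace [U] of
    [X] to [Y]. The values of [mor_fun] outside of [U] are irrelevant, and
    [pull V] is only meaningful for open [V]. *)
Record morphism X (U : set X) Y := Morphism {
  mor_fun :> X -> Y;
  pull : forall V : set Y, sec Y V -> sec X (U `&` mor_fun @^-1` V);
  mor_cont : forall V, open V -> open (U `&` mor_fun @^-1` V);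
  pull_rmorphism : forall V, open V -> is_rmorphism (@pull V);
  pull_res : forall (V V' : set Y) (s : sec Y V),
    open V -> open V' -> V' `<=` V ->
    pull (res V' s) = res (U `&` mor_fun @^-1` V') (pull s);
  pull_const : forall V c, open V ->
    pull (constant V c) = constant (U `&` mor_fun @^-1` V) c;
  pull_local : forall (V : set Y) (s : sec Y V) (x : X),
    open V -> U x -> V (mor_fun x) ->
    germ_unit (pull s) x -> germ_unit s (mor_fun x)
}.

Arguments pull {X U Y} f {V} s : rename.

(** [f] and [g] have the same restriction to the open set [W], for
    [W `<=` U `&` U']. *)
Definition agree_on X Y (U U' : set X) (W : set X)
    (f : morphism U Y) (g : morphism U' Y) : Prop :=
  (forall x, W x -> f x = g x) /\
  (forall (V : set Y) (s : sec Y V), open V ->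
     res (W `&` f @^-1` V) (pull f s) = res (W `&` f @^-1` V) (pull g s)).

(** [p \o g = f] *)
Definition is_comp X Y Z (U : set X)
    (g : morphism U Y) (p : morphism [set: Y] Z) (f : morphism U Z) : Prop :=
  (forall x, U x -> f x = p (g x)) /\
  (forall (V : set Z) (s : sec Z V), open V ->
     res (U `&` f @^-1` V) (pull g (pull p s)) = pull f s).

Definition is_identity X (f : morphism [set: X] X) : Prop :=
  (forall x, f x = x) /\
  (forall (V : set X) (s : sec X V), open V ->
     pull f s = res ([set: X] `&` f @^-1` V) s).

(** [P], with projections [p1] and [p2], is the fibre product of [X] with [Y]
    over Spec k. The test objects are the open subschemes of all k-schemes,
    i.e. all k-schemes. *)
Definition is_product X Y (P : kspace k)
    (p1 : morphism [set: P] X) (p2 : morphism [set: P] Y) : Prop :=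
  is_scheme P /\
  forall (T : kspace k) (U : set T), is_scheme T -> open U ->
  forall (f1 : morphism U X) (f2 : morphism U Y),
    (exists h : morphism U P, is_comp h p1 f1 /\ is_comp h p2 f2) /\
    (forall h h' : morphism U P,
       is_comp h p1 f1 -> is_comp h p2 f2 ->
       is_comp h' p1 f1 -> is_comp h' p2 f2 -> agree_on U h h').

Definition closed_immersion X Y (j : morphism [set: X] Y) : Prop :=
  [/\ closed (range j),
      injective j,
      forall U : set X, open U -> exists2 V : set Y, open V & U = j @^-1` V &
      (* surjectivity on stalks *)
      forall (U : set X) (s : sec X U) (x : X), open U -> U x ->
        exists (V : set Y) (t : sec Y V) (W : set X),
          [/\ open V, V (j x), open W, W x &
              W `<=` U `&` j @^-1` V /\ res W (pull j t) = res W s]].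

(** The diagonal [X -> X x_k X] is a closed immersion. *)
Definition separated X : Prop :=
  exists (P : kspace k) (p1 p2 : morphism [set: P] X)
         (id_X : morphism [set: X] X) (diag : morphism [set: X] P),
    [/\ is_product p1 p2, is_identity id_X,
        is_comp diag p1 id_X, is_comp diag p2 id_X & closed_immersion diag].

Record is_variety X : Prop := IsVariety {
  variety_scheme : is_scheme X;
  variety_irreducible : irreducible X;
  variety_reduced : reduced X;
  variety_separated : separated X;
  variety_finite_type : finite_type X
}.

(** [x] belongs to X(k): the residue field of [x] is k, that is, every germ at
    [x] is congruent to a constant modulo the maximal ideal of the stalk. *)
Definition rational_point X (x : X) : Prop :=
  forall (U : set X) (s : sec X U), open U -> U x ->
    exists c : k, ~ germ_unit (s - constant U c) x.

(** * Rational maps *)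

Record partial_map X Y := PartialMap {
  dom : set X;
  dom_open : open dom;
  dom_dense : dense dom;
  partial_mor :> morphism dom Y
}.

Definition partial_equiv X Y (r s : partial_map X Y) : Prop :=
  exists W : set X,
    [/\ open W, dense W, W `<=` dom r `&` dom s & agree_on W r s].

(** A rational map is an equivalence class of partial maps. *)
Record rational_map X Y := RationalMap {
  rat_class : set (partial_map X Y);
  rat_classP : exists r, rat_class = partial_equiv r
}.

(** The complement of the indeterminacy locus of [f]. *)
Definition rat_dom X Y (f : rational_map X Y) : set X :=
  [set x | exists2 r, rat_class f r & dom r x].

(** [x] is not in the indeterminacy locus of [f], and [f(x) = y]. *)
Definition rat_value X Y (f : rational_map X Y) (x : X) (y : Y) : Prop :=
  exists r, [/\ rat_class f r, dom r x & r x = y].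

Definition dominant X Y (f : rational_map X Y) : Prop :=
  exists2 r, rat_class f r & dense (r @` dom r).

(** [f^n(x)] is defined and equal to [y]. *)
Fixpoint rat_iter X (f : rational_map X X) (n : nat) (x y : X) : Prop :=
  if n is m.+1 then exists2 z, rat_iter f m x z & rat_value f z y else x = y.

Definition orbit_defined X (f : rational_map X X) (x : X) : Prop :=
  forall n, exists2 y, rat_iter f n x y & rat_dom f y.

End Spaces.

(** * Banach density *)

Definition card_int (S : set int) : nat := #|` fset_set S|.

Definition banach_density_zero (R : realType) (S : set int) : Prop :=
  forall a b : nat -> int,
    (forall n, a n <= b n <= 0) ->
    (card_int `[a n, b n] @[n --> \oo] --> \oo) ->
    ((card_int (S `&` `[a n, b n]))%:R / (card_int `[a n, b n])%:R : R)
      @[n --> \oo] --> (0 : R).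

(* Main.v *)
(** The set of points underlying a variety is a noetherian space, and rational
    maps are single-valued on points because varieties are separated; the rest
    of the argument is topological. Write [S_C] for the set of times at which
    the sequence [x] visits [C], and suppose that [S_V] does not have Banach
    density zero. Let [C], contained in [V], be closed and minimal with this
    property. A set of integers that does not have density zero meets one of
    its translates by some [d > 0] in a set that does not have density zero
    either; hence the points [y] of [C] with [f^d(y)] in [C], or undefined, form
    a closed set with the same property, and by minimality [f^d] maps [C] into
    [C]. As [x] visits [C] at arbitrarily negative times, each [x_n] lies in
    [f^i(C)] for some [i < d]. By density and irreducibility some [f^i(C)] is
    dense, and as [f^(d - i)] is dominant so is [f^d(C)], which is contained in
    [C]: a contradiction. *)

From mathcomp Require Import all_boot all_order all_algebra finmap.
From mathcomp Require Import all_classical all_reals all_analysis.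
From mathcomp Require Import zify ring lra.
Require Import Defs.

Set Implicit Arguments.
Unset Strict Implicit.
Unset Printing Implicit Defensive.

Import Order.TTheory GRing.Theory Num.Theory.
Import numFieldNormedType.Exports.

Local Open Scope classical_set_scope.
Local Open Scope ring_scope.

(** * Hilbert's basis theorem *)

Section Noetherian.
Variable A : comPzRingType.
Implicit Types (S J E : set A) (a b c g y z : A).

Definition is_subring S : Prop :=
  [/\ S 1, S (- 1), forall a b, S a -> S b -> S (a + b) &
      forall a b, S a -> S b -> S (a * b)].

Definition is_submodule S J : Prop :=
  [/\ J 0, forall y z, J y -> J z -> J (y + z) &
      forall c y, S c -> J y -> J (c * y)].

Definition span S E : set A :=
  [set y | forall J, is_submodule S J -> E `<=` J -> J y].

(** The ascending chain condition on ideals of [S], in sequence form. [S] is a subset of a fixed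
    ring, so that generators can be adjoined one by one inside a single type. *)
Definition noetherian S : Prop :=
  forall s : nat -> A, (forall n, S (s n)) ->
    exists n, span S (s @` `I_n) (s n).

(** Values at [g] of polynomials over [S] of degree strictly below [d]; such an expression need not
    be unique. *)
Fixpoint adjoin_upto S g (d : nat) : set A :=
  if d is e.+1
  then [set y | exists a z, [/\ S a, adjoin_upto S g e z & y = z + a * g ^+ e]]
  else [set 0].

Definition adjoin S g : set A := [set y | exists d, adjoin_upto S g d y].

Lemma subset_span S E : E `<=` span S E.
Proof. by move=> y Ey J _; apply. Qed.

Lemma span_submodule S E : is_submodule S (span S E).
Proof.
split; first by move=> J [J0 _ _] _.
- move=> y z Hy Hz J HJ EJ; have [_ JD _] := HJ.
  by apply: JD; [exact: Hy|exact: Hz].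
- move=> c y Sc Hy J HJ EJ; have [_ _ JM] := HJ.
  by apply: JM => //; exact: Hy.
Qed.

Lemma span_sub S E J : is_submodule S J -> E `<=` J -> span S E `<=` J.
Proof. by move=> HJ EJ y; apply. Qed.

Lemma span_mono S E1 E2 : E1 `<=` E2 -> span S E1 `<=` span S E2.
Proof. by move=> E12 y Hy J HJ E2J; apply: Hy => // z /E12 /E2J. Qed.

Section Adjoin.
Variables (S : set A) (g : A).
Hypothesis S_subring : is_subring S.

Let S1 : S 1. Proof. by case: S_subring. Qed.
Let SN1 : S (- 1). Proof. by case: S_subring. Qed.
Let SD a b : S a -> S b -> S (a + b). Proof. by case: S_subring => ? ? + _; apply. Qed.
Let SM a b : S a -> S b -> S (a * b). Proof. by case: S_subring => ? ? _; apply. Qed.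
Let S0 : S 0. Proof. by rewrite -(addrN 1); exact: SD. Qed.

Lemma adjoin_upto0 d : adjoin_upto S g d 0.
Proof. by elim: d => //= d IH; exists 0, 0; rewrite mul0r addr0. Qed.

Lemma adjoin_upto_mono d e y :
  (d <= e)%N -> adjoin_upto S g d y -> adjoin_upto S g e y.
Proof.
move=> /subnKC <-; elim: (e - d)%N => [|m IH] Hy; first by rewrite addn0.
by rewrite addnS /=; exists 0, y; split; rewrite ?mul0r ?addr0//; exact: IH.
Qed.

Lemma adjoin_uptoD d y z :
  adjoin_upto S g d y -> adjoin_upto S g d z -> adjoin_upto S g d (y + z).
Proof.
elim: d y z => [|d IH] y z /=; first by move=> -> ->; rewrite addr0.
move=> [a [u [Sa Hu ->]]] [b [v [Sb Hv ->]]].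
by exists (a + b), (u + v); split; [exact: SD|exact: IH|ring].
Qed.

Lemma adjoin_uptoZ d c y :
  S c -> adjoin_upto S g d y -> adjoin_upto S g d (c * y).
Proof.
move=> Sc; elim: d y => [|d IH] y /=; first by move=> ->; rewrite mulr0.
move=> [a [u [Sa Hu ->]]].
by exists (c * a), (c * u); split; [exact: SM|exact: IH|ring].
Qed.

Lemma adjoin_uptoB d y z :
  adjoin_upto S g d y -> adjoin_upto S g d z -> adjoin_upto S g d (y - z).
Proof. by move=> Hy Hz; apply: adjoin_uptoD => //; rewrite -mulN1r; exact: adjoin_uptoZ. Qed.

Lemma adjoin_upto_shift d e y :
  adjoin_upto S g d y -> adjoin_upto S g (d + e) (y * g ^+ e).
Proof.
elim: d y => [|d IH] y /=; first by move=> ->; rewrite mul0r; exact: adjoin_upto0.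
move=> [a [u [Sa Hu ->]]].
by exists a, (u * g ^+ e); split; [|exact: IH|rewrite exprD; ring].
Qed.

Lemma adjoin_uptoM d e y z :
  adjoin_upto S g d y -> adjoin_upto S g e z -> adjoin_upto S g (d + e) (y * z).
Proof.
elim: d y => [|d IH] y; first by move=> -> _; rewrite mul0r; exact: adjoin_upto0.
move=> [a [u [Sa Hu ->]]] Hz; rewrite mulrDl; apply: adjoin_uptoD.
  by apply: adjoin_upto_mono (IH _ Hu Hz); rewrite addSn.
rewrite -mulrA; apply: adjoin_uptoZ => //; rewrite mulrC.
by apply: adjoin_upto_mono (adjoin_upto_shift d Hz); lia.
Qed.

Lemma sub_adjoin : S `<=` adjoin S g.
Proof. by move=> a Sa; exists 1, a, 0; rewrite expr0 mulr1 add0r. Qed.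

Lemma adjoin_gen : adjoin S g g.
Proof. by exists 2, 1, 0; rewrite expr1 mul1r add0r; split=> //; exact: adjoin_upto0. Qed.

Lemma adjoin_subring : is_subring (adjoin S g).
Proof.
split; [exact: sub_adjoin|exact: sub_adjoin| |].
- move=> y z [d Hy] [e Hz]; exists (maxn d e); apply: adjoin_uptoD.
    by apply: adjoin_upto_mono Hy; exact: leq_maxl.
  by apply: adjoin_upto_mono Hz; exact: leq_maxr.
- by move=> y z [d Hy] [e Hz]; exists (d + e)%N; exact: adjoin_uptoM.
Qed.

(* [f n] is an element of least degree [d n], with
   leading coefficient [a n], among those of the ideal generated by [s] that
   do not belong to the ideal generated by [f 0], ..., [f (n - 1)]. *)
Lemma noetherian_adjoin : noetherian S -> noetherian (adjoin S g).
Proof.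
set T := adjoin S g => noethS s Ts; apply: contrapT => /forallNP s_new.
have [T1 TN1 TD TM] := adjoin_subring.
pose I : set A := [set y | exists n, span T (s @` `I_n) y].
have T_submod : is_submodule T T by split=> //; exact: sub_adjoin.
have IT : I `<=` T by move=> y [n]; apply: span_sub => // _ [i _ <-]; exact: Ts.
(* Such an [E] cannot generate all of [I], because some [s n] is new. Only for these sets is [good]
   required; elsewhere [pick] takes a dummy value. *)
pose fg E := exists n, E `<=` span T (s @` `I_n).
pose good (E : set A) (p : A * nat * A) :=
  let: (y, d, a) := p in
  [/\ I y, ~ span T E y, S a, exists2 z, adjoin_upto S g d z & y = z + a * g ^+ d &
      forall y', I y' -> adjoin_upto S g d y' -> span T E y'].
have /choice[pick pickP] : forall E, exists p, fg E -> good E p.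
  move=> E; have [[n En]|nfg] := pselect (fg E); last by exists (0, 0%N, 0).
  pose Q e := `[< exists y, [/\ I y, ~ span T E y & adjoin_upto S g e y] >].
  have exQ : exists e, Q e.
    have [e He] := Ts n; exists e; apply/asboolP; exists (s n); split=> //.
      by exists n.+1; apply: subset_span; exists n => /=.
    by move=> Hs; apply: (s_new n); apply: span_sub Hs => //; exact: span_submodule.
  case: (ex_minnP exQ) => -[|d] /asboolP[y [Iy Ey Py]] dmin.
    by case: Ey; rewrite Py; case: (span_submodule T E).
  have [a [z [Sa Pz yE]]] := Py.
  exists (y, d, a) => _; split=> //; first by exists z.
  move=> y' Iy' Py'; apply: contrapT => Ey'.
  have /dmin : Q d by apply/asboolP; exists y'.
  by rewrite ltnn.
pose E := fix E n := if n is m.+1 then E m `|` [set (pick (E m)).1.1] else set0.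
pose f n := (pick (E n)).1.1; pose d n := (pick (E n)).1.2; pose a n := (pick (E n)).2.
have E_mono i j : (i <= j)%N -> E i `<=` E j.
  move=> /subnKC <-; elim: (j - i)%N => [|m IH]; first by rewrite addn0.
  by rewrite addnS /=; apply: subset_trans IH _; exact: subsetUl.
have span_s_mono i j : (i <= j)%N -> span T (s @` `I_i) `<=` span T (s @` `I_j).
  move=> ij; apply: span_mono; apply: image_subset => m /= mi.
  exact: leq_trans ij.
have E_fg n : fg (E n).
  elim: n => [|n [N HN]]; first by exists 0%N => ?.
  have := pickP _ (ex_intro _ N HN).
  case def_p: (pick (E n)) => [[y e] b] [[N' HN'] _ _ _ _].
  exists (maxn N N') => z /= [/HN|->].
    by apply: span_s_mono; exact: leq_maxl.
  by rewrite def_p; apply: span_s_mono HN'; exact: leq_maxr.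
have goodE n : good (E n) (f n, d n, a n).
  by rewrite /f /d /a; have := pickP _ (E_fg n); case: (pick (E n)) => [[]].
have fE i n : (i < n)%N -> E n (f i) by move=> /E_mono; apply; right.
have [n a_n] : exists n, span S (a @` `I_n) (a n).
  by apply: noethS => n; case: (goodE n).
have [If nEf _ [z Pz fn] f_min] := goodE n.
(* If [d n < d i], minimality at stage [i] would put [f n] in the span of [E i]. *)
have d_mono i : (i < n)%N -> (d i <= d n)%N.
  move=> i_n; rewrite leqNgt; apply/negP => dn_di.
  have [_ _ _ _ i_min] := goodE i; apply: nEf.
  apply: (span_mono (E_mono _ _ (ltnW i_n))); apply: i_min => //.
  by apply: (adjoin_upto_mono dn_di) => /=; exists (a n), z; split=> //; case: (goodE n).
(* The possible coefficients of [g ^+ d n] in elements of the span of [E n] of degree at most [d n].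
   This [S]-submodule contains each earlier [a i], through [f i * g ^+ (d n - d i)], hence also
   [a n]. *)
pose J := [set c | exists y w, [/\ span T (E n) y, adjoin_upto S g (d n) w &
                               y = w + c * g ^+ d n]].
have [sp0 spD spM] := span_submodule T (E n).
have [y [w [Ey Pw yE]]] : J (a n).
  apply: a_n; first split.
  - by exists 0, 0; split=> //; [exact: adjoin_upto0|ring].
  - move=> c c' [y [w [Hy Hw yE]]] [y' [w' [Hy' Hw' yE']]].
    exists (y + y'), (w + w'); split; [exact: spD|exact: adjoin_uptoD|].
    by rewrite yE yE'; ring.
  - move=> c c' Sc [y [w [Hy Hw yE]]]; exists (c * y), (c * w); split.
    + by apply: spM => //; exact: sub_adjoin.
    + exact: adjoin_uptoZ.
    + by rewrite yE; ring.
  move=> _ [i /= i_n <-]; have [_ _ _ [w Hw fi] _] := goodE i.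
  exists (f i * g ^+ (d n - d i)), (w * g ^+ (d n - d i)); split.
  - rewrite mulrC; apply: spM; last by apply: subset_span; exact: fE.
    elim: (d n - d i)%N => [|e IH]; first by rewrite expr0.
    by rewrite exprS; apply: TM => //; exact: adjoin_gen.
  - have := adjoin_upto_shift (d n - d i) Hw.
    by rewrite subnKC // d_mono.
  - by rewrite fi mulrDl -mulrA -exprD subnKC // d_mono.
have I_span : span T (E n) `<=` I.
  have [N HN] := E_fg n => v Hv; exists N.
  exact: (span_sub (span_submodule _ _) HN Hv).
(* The leading terms of [f n] and [y] cancel, so the difference has degree below [d n] and lies in
   the span by minimality. *)
apply: nEf; rewrite (_ : f n = y + (f n - y)); last by ring.
apply: spD => //; apply: f_min; last first.
  by rewrite fn yE (_ : _ - _ = z - w); [exact: adjoin_uptoB|ring].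
have [N1 HN1] := If; have [N2 HN2] := I_span _ Ey.
exists (maxn N1 N2); have [_ qD qM] := span_submodule T (s @` `I_(maxn N1 N2)).
apply: qD; first by apply: span_s_mono HN1; exact: leq_maxl.
rewrite -mulN1r; apply: qM => //; apply: span_s_mono HN2; exact: leq_maxr.
Qed.

End Adjoin.
End Noetherian.

(** The basis theorem is applied once per generator, starting from the image of the field; the
    subring reached contains all constants and generators, so it is [B]. *)
Lemma fin_gen_noetherian (k : fieldType) (B : comPzRingType) (i : k -> B) :
  is_rmorphism i -> fin_gen_algebra i -> noetherian [set: B].
Proof.
move=> [iB [i1 iM]] [gens gensP].
have iN c : i (- c) = - i c.
  have i0 : i 0 = 0 by rewrite -(subrr 0) iB subrr.
  by rewrite -sub0r iB i0 sub0r.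
have iD c c' : i (c + c') = i c + i c'.
  by have := iB c (- c'); rewrite iN !opprK.
have range_subring : is_subring (range i).
  split; [by exists 1|by exists (- 1); rewrite // iN i1| |].
    by move=> _ _ [c _ <-] [c' _ <-]; exists (c + c').
  by move=> _ _ [c _ <-] [c' _ <-]; exists (c * c').
have range_noetherian : noetherian (range i).
  move=> s ks; have [c _ sc] := ks 0%N.
  (* Either [s 0] vanishes and lies in the span of no elements, or it is invertible and [s 1] is a
     multiple of it. *)
  have [c0|c0] := eqVneq c 0.
    exists 0%N => J [J0 _ _] _.
    by rewrite -sc c0 -(subrr 0) iB subrr.
  exists 1%N => J [_ _ JM] EJ.
  have [c' _ sc'] := ks 1%N.
  have -> : s 1%N = i (c' / c) * s 0%N by rewrite -sc -iM divfK.
  by apply: JM; [exists (c' / c)|apply: EJ; exists 0%N].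
have [S [Ssub Snoeth iS gS]] : exists S : set B, [/\ is_subring S, noetherian S,
    range i `<=` S & forall g, g \in gens -> S g].
  elim: gens {gensP} => [|g gens [S [Ssub Snoeth iS gS]]].
    by exists (range i); split=> // g; rewrite in_nil.
  exists (adjoin S g); split.
  - exact: adjoin_subring.
  - exact: noetherian_adjoin.
  - by apply: subset_trans iS _; exact: sub_adjoin.
  - move=> h; rewrite inE => /orP[/eqP->|/gS]; first exact: adjoin_gen.
    exact: sub_adjoin.
have [_ _ SD SM] := Ssub.
by rewrite -(gensP S) // => c; apply: iS; exists c.
Qed.

(** * Noetherian spaces *)

(** The descending chain condition for traces on [U] of closed sets: the [x n] would witness that
    the intersections of [C 0], ..., [C n] shrink at every step. *)
Definition noetherian_set (T : topologicalType) (U : set T) : Prop :=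
  forall (C : nat -> set T) (x : nat -> T),
    (forall n, closed (C n)) -> (forall n, U (x n)) ->
    (forall i n, (i < n)%N -> C i (x n)) -> exists n, C n (x n).

Lemma infinite_subsequence (S : set nat) :
  infinite_set S -> exists2 u : nat -> nat, {homo u : i j / (i < j)%N} & forall n, S (u n).
Proof.
move=> infS.
have /choice[next nextP] : forall m, exists n, (m < n)%N /\ S n.
  move=> m; apply: contrapT => /forallNP Sm; apply: infS.
  apply: (sub_finite_set _ (finite_II m.+1)) => n Sn /=; rewrite ltnS leqNgt.
  by apply/negP => mn; apply: (Sm n).
exists (fun n => iter n.+1 next 0%N); last by move=> n; case: (nextP (iter n next 0%N)).
by apply: homo_ltn => [? ? ?|n]; [exact: ltn_trans|case: (nextP (iter n.+1 next 0%N))].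
Qed.

(** By pigeonhole one member of the cover contains infinitely many [x n], and the hypotheses pass to
    that subsequence. *)
Lemma noetherian_cover (T : topologicalType) (F : set (set T)) :
  finite_set F -> \bigcup_(U in F) U = setT ->
  (forall U, F U -> noetherian_set U) -> noetherian_set [set: T].
Proof.
move=> finF FT noethF C x C_closed _ Cx.
have [U FU infU] : exists2 U, F U & infinite_set [set n | U (x n)].
  apply: contrapT => /forall2NP finU; apply: infinite_nat.
  have -> : [set: nat] = \bigcup_(U in F) [set n | U (x n)].
    apply/seteqP; split=> // n _.
    by have : [set: T] (x n) by []; rewrite -FT => -[U FU Ux]; exists U.
  apply: bigcup_finite => // U FU.
  by have [//|/contrapT] := finU U.
have [u u_mono Uu] := infinite_subsequence infU.
have [n Cn] : exists n, C (u n) (x (u n)).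
  apply: (noethF U FU (C \o u) (x \o u)) => //= i j ij.
  by apply: Cx; exact: u_mono.
by exists (u n).
Qed.

(** Without a minimal member, repeated choice gives strictly decreasing sets [C n]; points of [C n]
    outside [C n.+1] contradict noetherianity, applied to the sequence shifted by one. *)
Lemma noetherian_minimal (T : topologicalType) (F : set (set T)) :
  noetherian_set [set: T] -> F `<=` closed -> F !=set0 ->
  exists2 C, F C & forall C', F C' -> C' `<=` C -> C' = C.
Proof.
move=> noethT Fc [C0 FC0]; apply: contrapT => /forall2NP nomin.
have /choice[next nextP] : forall C, exists C', F C -> [/\ F C', C' `<=` C & C' <> C].
  move=> C; have [FC|] := pselect (F C); last by exists C.
  have [//|/existsNP[C' /not_implyP[FC' /not_implyP[C'C neq]]]] := nomin C.
  by exists C'.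
pose C n := iter n next C0.
have FC n : F (C n) by elim: n => [|n /nextP[]].
have /choice[x xP] : forall n, exists x, C n x /\ ~ C n.+1 x.
  move=> n; have [_ sub neq] := nextP _ (FC n); apply: contrapT => /forallNP nx.
  apply: neq; apply/seteqP; split=> // x Cx; apply: contrapT => nCx.
  by apply: (nx x).
have C_dec i j : (i <= j)%N -> C j `<=` C i.
  move=> /subnKC <-; elim: (j - i)%N => [|m IH]; first by rewrite addn0.
  by rewrite addnS; apply: subset_trans IH; case: (nextP _ (FC (i + m)%N)).
have [n Cn] : exists n, C n.+1 (x n).
  apply: (noethT (fun n => C n.+1) x) => // [n|i n ij]; first exact: Fc.
  by apply: (C_dec _ _ ij); case: (xP n).
by case: (xP n).
Qed.

(** * Schemes of finite type over a field are noetherian spaces *)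

Lemma rmorphism_comp (A B C : comPzRingType) (f : A -> B) (g : B -> C) :
  is_rmorphism f -> is_rmorphism g -> is_rmorphism (g \o f).
Proof.
move=> [fB [f1 fM]] [gB [g1 gM]]; split; first by move=> a b /=; rewrite fB gB.
by split=> [|a b] /=; rewrite ?f1 ?fM.
Qed.

Section Schemes.
Variable k : fieldType.
Implicit Types X : kspace k.

Lemma constant_rmorphism X (U : set X) : open U -> is_rmorphism (@constant k X U).
Proof.
move=> oU; apply: rmorphism_comp; first exact: const_rmorphism.
by apply: res_rmorphism => //; exact: openT.
Qed.

(** The principal open set of [1] is all of [U], so localization at [1] makes [phi] bijective. *)
Lemma global_sections X (U : set X) (A : comPzRingType)
    (h : X -> prime_spectrum A) (phi : A -> sec X U) : is_spec h phi ->
  [/\ is_rmorphism phi, forall a, phi a = 0 -> a = 0 & forall s, exists a, phi a = s].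
Proof.
move=> [oU _ _ /(_ 1)].
have -> : U `&` [set x | ~ prime_set (h x) 1] = U.
  by apply/seteqP; split=> [x []//|x Ux]; split=> //; exact: prime1.
have -> : (fun b => res U (phi b)) = phi by apply/funext => b; exact: res_id.
move=> [phi_mor _ phi_surj phi_inj]; split=> //.
- by move=> a /phi_inj[n]; rewrite expr1n mul1r.
- move=> s; have [b [n]] := phi_surj s; have [_ [-> _]] := phi_mor.
  by rewrite expr1n mulr1 => ->; exists b.
Qed.

(** On [U], each [C n] is cut out by equations [E n]. If [x n] were never in [C n], some [s n] in
    [E n] would not vanish at [x n], while every [s i] with [i < n] does; this contradicts
    noetherianity of the ring of sections. *)
Lemma affine_noetherian X (U : set X) :
  affine_open U -> fin_gen_algebra (@constant k X U) -> noetherian_set U.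
Proof.
move=> [A [h [phi spec]]] fg C x C_closed Ux Cx.
have [oU _ oP _] := spec; have [phi_mor phi_inj phi_surj] := global_sections spec.
have [phiB [phi1 phiM]] := phi_mor.
have phi_i : injective phi.
  by move=> a b ab; apply/subr0_eq/phi_inj; rewrite phiB ab subrr.
have phiD a b : phi (a + b) = phi a + phi b.
  by apply: (addIr (- phi b)); rewrite addrK -phiB addrK.
apply: contrapT => /forallNP nC.
have /choice[E EP] : forall n, exists E : set A,
    forall y, U y -> (C n y <-> E `<=` prime_set (h y)).
  move=> n; have oW : open (U `&` ~` C n) by apply: openI => //; exact: closed_openC.
  have [|E hE] := (oP (U `&` ~` C n) _).1 oW; first by move=> y [].
  exists E => y Uy.
  have : (h @` (U `&` ~` C n)) (h y) <-> ~ (E `<=` prime_set (h y)) by rewrite hE.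
  have -> : (h @` (U `&` ~` C n)) (h y) <-> ~ C n y.
    split; last by move=> nCy; exists y.
    move=> [z [Uz nCz] hzy].
    have [_ [_ hinj _] _ _] := spec.
    by rewrite -(hinj z y) // inE.
  move=> [H1 H2]; split=> H; apply: contrapT => H'; tauto.
have /choice[s sP] : forall n, exists s, E n s /\ ~ prime_set (h (x n)) s.
  move=> n; have : ~ (E n `<=` prime_set (h (x n))) by move=> /(EP n _ (Ux n)) /(nC n).
  by move=> /existsNP[s /not_implyP[Es ps]]; exists s.
have [n sn] := fin_gen_noetherian (constant_rmorphism oU) fg
  (s := phi \o s) (fun=> I).
have [_ nsn] := sP n.
have [a pa ea] : [set phi a | a in prime_set (h (x n))] (phi (s n)).
  apply: sn.
    split; first by exists 0; [exact: prime0|rewrite -(subrr 0) phiB subrr].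
    - by move=> _ _ [a pa <-] [b pb <-]; exists (a + b); [exact: primeD|].
    - move=> c _ _ [b pb <-]; have [a <-] := phi_surj c.
      by exists (a * b); [exact: primeM|].
  move=> _ [i /= i_n <-]; exists (s i) => //.
  have [Esi _] := sP i; have /(EP i _ (Ux n)) := Cx _ _ i_n; exact.
by apply: nsn; rewrite -(phi_i _ _ ea).
Qed.

Lemma finite_type_noetherian X : finite_type X -> noetherian_set [set: X].
Proof.
move=> [F [finF FT FU]]; apply: noetherian_cover FT _ => // U /FU[aff fg].
exact: affine_noetherian.
Qed.

End Schemes.

(** * Single-valuedness of rational maps *)

Section Morphisms.
Variable k : fieldType.
Implicit Types X Y Z : kspace k.

Lemma germ_unit_res X (U V : set X) (s : sec X U) x :
  open U -> open V -> V `<=` U -> germ_unit (res V s) x -> germ_unit s x.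
Proof.
move=> oU oV VU [W [oW Wx WV]]; rewrite res_comp // => uW.
by exists W; split=> //; exact: subset_trans VU.
Qed.

Lemma constant_res X (U V : set X) c : open U -> open V -> V `<=` U ->
  res V (@constant k X U c) = @constant k X V c.
Proof. by move=> oU oV VU; rewrite /constant res_comp //; exact: openT. Qed.

(** * Restriction and composition of morphisms *)

Section Restriction.
Variables (X Y : kspace k) (U W : set X) (f : morphism U Y).
Hypotheses (oW : open W) (WU : W `<=` U).

Let restr_open (V : set Y) : open V -> open (W `&` f @^-1` V).
Proof.
move=> oV; rewrite (_ : _ `&` _ = W `&` (U `&` f @^-1` V)).
  by apply: openI => //; exact: mor_cont.
by rewrite setIA (setIidl WU).
Qed.

Let restr_sub (V : set Y) : W `&` f @^-1` V `<=` U `&` f @^-1` V.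
Proof. exact: setSI. Qed.

Definition restrict_morphism : morphism W Y.
Proof.
refine (@Morphism k X W Y f (fun V s => res (W `&` f @^-1` V) (pull f s)) _ _ _ _ _).
- exact: restr_open.
- move=> V oV; apply: rmorphism_comp; first exact: pull_rmorphism.
  by apply: res_rmorphism; [exact: mor_cont|exact: restr_open|].
- move=> V V' s oV oV' V'V; rewrite pull_res //.
  rewrite !res_comp //; try exact: mor_cont; try exact: restr_open.
  + by move=> x [Wx /V'V].
  + by move=> x [Ux /V'V].
- move=> V c oV; rewrite pull_const // constant_res //; first exact: mor_cont.
  exact: restr_open.
- move=> V s x oV Wx Vfx /germ_unit_res gu; apply: pull_local => //.
    exact: WU.
  by apply: gu; [exact: mor_cont|exact: restr_open|].
Defined.

End Restriction.

Section Composition.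
Variables (X Y Z : kspace k) (U : set X) (g : morphism U Y) (p : morphism [set: Y] Z).

Let pre_open (V : set Z) : open V -> open ([set: Y] `&` p @^-1` V).
Proof. exact: mor_cont. Qed.

Let preE (V : set Z) :
  U `&` g @^-1` ([set: Y] `&` p @^-1` V) = U `&` (p \o g) @^-1` V.
Proof. by rewrite setTI. Qed.

Let comp_open (V : set Z) : open V -> open (U `&` (p \o g) @^-1` V).
Proof. by move=> oV; rewrite -preE; apply: mor_cont; exact: pre_open. Qed.

Let comp_pre_open (V : set Z) : open V -> open (U `&` g @^-1` ([set: Y] `&` p @^-1` V)).
Proof. by move=> oV; rewrite preE; exact: comp_open. Qed.

(** The double pullback lives over an open set equal to the required one only through [preE];
    restriction between equal open sets serves as transport. *)
Definition comp_morphism : morphism U Z.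
Proof.
refine (@Morphism k X U Z (p \o g)
  (fun V s => res (U `&` (p \o g) @^-1` V) (pull g (pull p s))) _ _ _ _ _).
- exact: comp_open.
- move=> V oV.
  have pull_mor := rmorphism_comp (pull_rmorphism p oV) (pull_rmorphism g (pre_open oV)).
  apply: (rmorphism_comp pull_mor).
  by apply: res_rmorphism; [exact: comp_pre_open|exact: comp_open|rewrite preE].
- move=> V V' s oV oV' V'V; rewrite pull_res // pull_res; try exact: pre_open; last first.
    by move=> x [_ /V'V].
  rewrite !res_comp //; try exact: comp_pre_open; try exact: comp_open.
  all: try by rewrite preE.
  + by move=> x [Ux /V'V].
  + by move=> x [Ux [_ /V'V]].
- move=> V c oV; rewrite pull_const // pull_const; last exact: pre_open.
  by rewrite constant_res //; [exact: comp_pre_open|exact: comp_open|rewrite preE].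
- move=> V s x oV Ux Vx /germ_unit_res gu.
  have {}gu : germ_unit (pull g (pull p s)) x.
    by apply: gu; [exact: comp_pre_open|exact: comp_open|rewrite preE].
  apply: pull_local => //; apply: pull_local gu => //; exact: pre_open.
Defined.

End Composition.

Lemma is_comp_restrict X Y Z (U W : set X) (g : morphism U Y)
    (p : morphism [set: Y] Z) (f : morphism U Z)
    (oW : open W) (WU : W `<=` U) :
  is_comp g p f ->
  is_comp (restrict_morphism g oW WU) p (restrict_morphism f oW WU).
Proof.
move=> [gpf pull_gpf]; split=> [x /WU /gpf //|V s oV] /=.
rewrite -pull_gpf //.
have o1 : open ([set: Y] `&` p @^-1` V) by exact: mor_cont.
have o2 := mor_cont g o1; have o3 := mor_cont f oV.
have o4 := mor_cont (restrict_morphism f oW WU) oV.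
have o5 := mor_cont (restrict_morphism g oW WU) o1.
rewrite !res_comp //=.
all: move=> x /= [Wx]; first [have Ux := WU x Wx|have Ux := Wx].
all: rewrite ?gpf //; tauto.
Qed.

Lemma agree_restrict X Y (U U' N W : set X) (f : morphism U Y) (f' : morphism U' Y)
    (oN : open N) (NU : N `<=` U) (NU' : N `<=` U') : open W -> W `<=` N ->
  agree_on W f f' ->
  agree_on W (restrict_morphism f oN NU) (restrict_morphism f' oN NU').
Proof.
move=> oW WN [ff' pull_ff']; split=> // V s oV.
have o1 := mor_cont f oV; have o2 := mor_cont f' oV.
have o3 := mor_cont (restrict_morphism f oN NU) oV.
have o4 := mor_cont (restrict_morphism f' oN NU') oV.
have o5 := mor_cont (restrict_morphism f oW (subset_trans WN NU)) oV.
rewrite /= in o3 o4 o5 *; rewrite !res_comp //; first exact: pull_ff'.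
all: move=> x /= [Wx].
all: first [have Nx := WN x Wx; rewrite ?ff' //|have Nx := Wx].
all: by have := NU x Nx; have := NU' x Nx; tauto.
Qed.

Lemma is_comp_agree X Y Z (U : set X) (g : morphism U Y)
    (p : morphism [set: Y] Z) (f f' : morphism U Z) :
  is_comp g p f -> agree_on U f f' -> is_comp g p f'.
Proof.
move=> [gpf pull_gpf] [ff' pull_ff']; split=> [x Ux|V s oV]; first by rewrite -ff' ?gpf.
have o1 := mor_cont f oV; have o2 := mor_cont f' oV.
have o3 := mor_cont p oV; have o4 := mor_cont g o3.
have sub : U `&` f' @^-1` V `<=` U `&` f @^-1` V.
  by move=> x /= [Ux]; rewrite ff'.
have sub' : U `&` f @^-1` V `<=` U `&` g @^-1` ([set: Y] `&` p @^-1` V).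
  by move=> x /= [Ux]; rewrite gpf.
rewrite -(res_comp _ o4 o1 o2 sub' sub) pull_gpf //.
rewrite -[pull f s](res_id _ o1) pull_ff' // res_comp ?res_id //.
by move=> x /= [Ux]; rewrite ff'.
Qed.

Lemma is_comp_section X P (U : set X) (Y : kspace k) (f : morphism U Y)
    (diag : morphism [set: Y] P) (p : morphism [set: P] Y) (id_Y : morphism [set: Y] Y) :
  is_identity id_Y -> is_comp diag p id_Y -> is_comp (comp_morphism f diag) p f.
Proof.
move=> [idE pull_id] [dpE pull_dp]; split=> [x Ux|V s oV] /=.
  by rewrite -dpE // idE.
have o1 := mor_cont f oV; have o2 := mor_cont id_Y oV; have o3 := mor_cont p oV.
have o4 := mor_cont diag o3; have o5 := mor_cont f o4; have o6 := mor_cont f o2.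
have o7 := mor_cont (comp_morphism f diag) o3.
have sub : [set: Y] `&` id_Y @^-1` V `<=` [set: Y] `&` diag @^-1` ([set: P] `&` p @^-1` V).
  by move=> y /= [_]; rewrite dpE.
have sub1 : [set: Y] `&` id_Y @^-1` V `<=` V by move=> y /= [_]; rewrite idE.
have /(congr1 (fun t => res (U `&` f @^-1` V) (pull f t))) := pull_dp V s oV.
rewrite pull_id // !pull_res // !res_comp ?res_id //.
all: try by move=> x /= [Ux]; rewrite ?idE -?dpE ?idE //; tauto.
Qed.

(* The closed diagonal contains the image of [W] under [(r, r')], hence also that
   of its closure in [U `&` U']. *)
Lemma separated_agree X Y (U U' W : set X) (r : morphism U Y) (r' : morphism U' Y) :
  is_scheme X -> separated Y -> open U -> open U' -> open W -> dense W ->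
  W `<=` U `&` U' -> agree_on W r r' -> forall x, U x -> U' x -> r x = r' x.
Proof.
move=> schX [P [p1 [p2 [id_Y [diag [prodP idY diag1 diag2 [diag_closed _ _ _]]]]]]].
move=> oU oU' oW dW WUU' rr' x Ux U'x.
have oN : open (U `&` U') by exact: openI.
pose rN := restrict_morphism r oN (@subIsetl _ _ _).
pose r'N := restrict_morphism r' oN (@subIsetr _ _ _).
have rrN : agree_on W rN r'N by exact: agree_restrict.
have [_ prod_univ] := prodP.
have [[h [h1 h2]] _] := prod_univ X _ schX oN rN r'N.
pose rW := restrict_morphism rN oW WUU'; pose r'W := restrict_morphism r'N oW WUU'.
have rrW : agree_on W rW r'W by exact: agree_restrict.
(* Over [W] both morphisms to [P] have projections [rW] and [r'W], so the uniqueness in the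
   universal property identifies them. *)
have [_ /(_ (restrict_morphism h oW WUU') (comp_morphism rW diag)) hdiag] :=
  prod_univ X _ schX oW rW r'W.
have {hdiag}[hdiag _] : agree_on W (restrict_morphism h oW WUU') (comp_morphism rW diag).
  apply: hdiag; try exact: is_comp_restrict.
  - exact: is_comp_section idY _.
  - apply: is_comp_agree rrW; exact: is_comp_section idY _.
have Nx : (U `&` U') x by [].
(* Otherwise the points that [h] sends off the closed diagonal form a nonempty open set, which meets
   the dense set [W]. *)
have [y _ hx] : range diag (h x).
  apply: contrapT => nhx.
  have oO : open (U `&` U' `&` h @^-1` (~` range diag)).
    by apply: mor_cont; exact: closed_openC.
  have [|z [[_ nhz] Wz]] := dW _ _ oO; first by exists x.
  by apply: nhz; rewrite /= (hdiag z Wz : h z = diag (r z)); exists (r z).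
have -> : r x = y by rewrite -(idY.1 y) (diag1.1 y) // hx -(h1.1 x).
by rewrite -(idY.1 y) (diag2.1 y) // hx -(h2.1 x).
Qed.

Lemma mor_cont_sub X Y (U W : set X) (f : morphism U Y) (V : set Y) :
  open W -> W `<=` U -> open V -> open (W `&` f @^-1` V).
Proof.
by move=> oW WU oV; have := openI oW (mor_cont f oV); rewrite setIA (setIidl WU).
Qed.

Lemma agree_sub X Y (U U' W W' : set X) (f : morphism U Y) (f' : morphism U' Y) :
  open W -> open W' -> W' `<=` W -> W `<=` U `&` U' ->
  agree_on W f f' -> agree_on W' f f'.
Proof.
move=> oW oW' W'W WUU' [ff' pull_ff']; split=> [x /W'W /ff' //|V s oV].
have [WU WU'] : W `<=` U /\ W `<=` U' by split=> x /WUU'[].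
have E (N : set X) : N `<=` W -> N `&` f @^-1` V = N `&` f' @^-1` V.
  by move=> NW; apply/seteqP; split=> x [Nx] /=; rewrite ff' //; exact: NW.
have o0 := mor_cont_sub f oW WU oV.
have o1 := mor_cont_sub f oW' (subset_trans W'W WU) oV.
rewrite -(res_comp (pull f s) (mor_cont f oV) o0 o1) ?pull_ff' //.
- by rewrite res_comp //; [exact: mor_cont|rewrite E //; exact: setSI|exact: setSI].
- exact: setSI.
- exact: setSI.
Qed.

Lemma agree_trans X Y (U U' U'' W : set X) (f : morphism U Y) (f' : morphism U' Y)
    (f'' : morphism U'' Y) :
  agree_on W f f' -> agree_on W f f'' -> agree_on W f' f''.
Proof.
move=> [ff' pull_ff'] [ff'' pull_ff'']; split=> [x Wx|V s oV].
  by rewrite -ff' // ff''.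
rewrite (_ : W `&` f' @^-1` V = W `&` f @^-1` V); first by rewrite -pull_ff' ?pull_ff''.
by apply/seteqP; split=> x [Wx] /=; rewrite ff'.
Qed.

(** Two representatives agree with a third on dense open sets, hence with each other on the
    intersection, again open and dense; separatedness extends this to their common domain. *)
Lemma rat_value_unique X Y (f : rational_map X Y) x y y' :
  is_scheme X -> separated Y -> rat_value f x y -> rat_value f x y' -> y = y'.
Proof.
move=> schX sepY [r [fr rx <-]] [r' [fr' r'x <-]].
have [r0 fE] := rat_classP f.
move: fr fr'; rewrite fE => -[W [oW dW WD r0r]] [W' [oW' dW' W'D r0r']].
have oWW' : open (W `&` W') by exact: openI.
have agr : agree_on (W `&` W') r r'.
  apply: (@agree_trans _ _ _ _ _ _ r0).
    exact: agree_sub oW oWW' (@subIsetl _ _ _) WD r0r.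
  exact: agree_sub oW' oWW' (@subIsetr _ _ _) W'D r0r'.
apply: (separated_agree schX sepY (dom_open r) (dom_open r') oWW' _ _ agr) => //.
- move=> O O0 oO; rewrite setIA; apply: dW'; last exact: openI.
  exact: dW.
- by move=> z [/WD[_ rz] /W'D[]].
Qed.

End Morphisms.

(** * Banach density *)

(** The window is half-open: a closed interval from [a] to [a + L] has window length [L.+1], and a
    window stays in the nonpositive integers when [a + L <= 1]. *)
Definition card_window (S : set int) (a : int) (L : nat) : nat :=
  count (fun i : nat => `[< S (a + i%:Z) >]) (iota 0 L).

Lemma card_int_window (S : set int) (a : int) (L : nat) :
  card_int (S `&` `[a, a + L%:Z]) = card_window S a L.+1.
Proof.
pose s := [seq a + i%:Z | i <- iota 0 L.+1 & `[< S (a + i%:Z) >]].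
have s_uniq : uniq s.
  rewrite map_inj_uniq ?filter_uniq ?iota_uniq // => i j /addrI.
  by move=> [].
have -> : S `&` `[a, a + L%:Z] = [set` [fset y in s]%fset].
  apply/seteqP; split=> y /=.
    rewrite in_itv /= => -[Sy /andP[ay yL]]; rewrite inE.
    apply/mapP; exists `|y - a|%N; last by lia.
    rewrite mem_filter mem_iota; apply/andP; split; last by lia.
    by apply/asboolP; rewrite (_ : a + _ = y) //; lia.
  rewrite inE => /mapP[i]; rewrite mem_filter mem_iota => /andP[/asboolP Si iL] ->.
  by split=> //; rewrite in_itv /=; lia.
rewrite /card_int set_fsetK card_fseq undup_id // size_map size_filter.
by [].
Qed.

Lemma card_int_itv (a : int) (L : nat) : card_int `[a, a + L%:Z] = L.+1.
Proof.
rewrite -[X in card_int X]setTI card_int_window /card_window.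
by rewrite (eq_count (a2 := predT)) ?count_predT ?size_iota // => i; apply/asboolP.
Qed.

(* Uniform in the position of the interval, unlike [banach_density_zero]. *)
Definition sparse (S : set int) : Prop :=
  forall M : nat, exists L0 : nat, forall (a : int) (L : nat),
    (L0 <= L)%N -> a + L%:Z <= 1 -> (M * card_window S a L <= L)%N.

Lemma sparse_banach (R : realType) (S : set int) :
  sparse S -> banach_density_zero R S.
Proof.
move=> sparseS a b ab0 len_oo.
have bE n : b n = a n + `|b n - a n|%N%:Z by have := ab0 n; lia.
apply/cvgrPdist_le => /= e e0.
pose M := (Num.truncn e^-1).+1.
have Me : e^-1 < M%:R by rewrite /M; exact: truncnS_gt.
have [L0 HL0] := sparseS M.
have : \forall n \near \oo, (L0 <= card_int `[a n, b n])%N.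
  exact: (len_oo [set m | (L0 <= m)%N] (nbhs_infty_ge L0)).
apply: filterS => n; rewrite bE card_int_window card_int_itv => L0L.
set L := _.+1 in L0L *.
have {L0L HL0} := HL0 (a n) L L0L.
have -> : a n + L%:Z <= 1 by have := ab0 n; have := bE n; rewrite /L; lia.
move=> /(_ isT) ML.
rewrite sub0r normrN ger0_norm ?divr_ge0 // ler_pdivrMr ?ltr0n //.
move: ML; rewrite -(ler_nat R) natrM => ML.
have M0 : 0 < M%:R :> R by rewrite ltr0n.
have eM : 1 <= e * M%:R by rewrite mulrC -ler_pdivrMr // mul1r ltW.
have L_ge0 : 0 <= (card_window S (a n) L)%:R :> R by [].
nra.
Qed.

Lemma sparse_sub (S T : set int) : S `<=` T -> sparse T -> sparse S.
Proof.
move=> ST sT M; have [L0 HL0] := sT M; exists L0 => a L L0L aL.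
apply: leq_trans (HL0 a L L0L aL); rewrite leq_mul2l; apply/orP; right.
by apply: sub_count => i /asboolP /ST ?; apply/asboolP.
Qed.

(** Quotients by [K] distinguish elements at least [K] apart, and take at most [L %/ K + 1] values
    below [L]. *)
Lemma separated_count (p : pred nat) (K L : nat) : (0 < K)%N ->
  (forall i j, p i -> p j -> (i < j)%N -> (i + K <= j)%N) ->
  (count p (iota 0 L) <= (L %/ K).+1)%N.
Proof.
move=> K0 sep; rewrite -size_filter -(size_map (divn^~ K)).
rewrite -[leqRHS](size_iota 0); apply: uniq_leq_size.
  rewrite map_inj_in_uniq ?filter_uniq ?iota_uniq // => i j.
  rewrite !mem_filter => /andP[pi _] /andP[pj _] ij.
  have := divn_eq i K; have := divn_eq j K; have := ltn_pmod i K0.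
  have := ltn_pmod j K0; rewrite ij.
  have := sep i j pi pj; have := sep j i pj pi.
  by lia.
move=> _ /mapP[i + ->]; rewrite mem_filter !mem_iota => /andP[_ /andP[_ iL]].
by rewrite /= add0n ltnS leq_div2r // ltnW.
Qed.

Definition returns (S : set int) (d : nat) : set int :=
  [set n | S n /\ S (n + d%:Z)].

(** Elements of [S] with no return in fewer than [K] steps are at least [K] apart; every other
    element is counted in some [returns S d] with [0 < d < K]. *)
Lemma window_shifts (S : set int) (a : int) (K L : nat) : (0 < K)%N ->
  (card_window S a L <= (L %/ K).+1 +
     \sum_(1 <= d < K) card_window (returns S d) a L)%N.
Proof.
move=> K0.
pose good i := `[< S (a + i%:Z) /\ forall d : nat, (0 < d < K)%N -> ~ S (a + i%:Z + d%:Z) >].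
have := @separated_count good K L K0.
have H : forall i j, good i -> good j -> (i < j)%N -> (i + K <= j)%N.
  move=> i j /asboolP[_ nS] /asboolP[Sj _] ij; rewrite leqNgt; apply/negP => jK.
  apply: (nS (j - i)%N); first by lia.
  by rewrite (_ : _ + _ = a + j%:Z) //; lia.
move=> /(_ H) good_le.
apply: leq_trans (leq_add good_le (leqnn _)).
rewrite /card_window; elim: (iota 0 L) => [|i s IH] /=; first by rewrite big1.
rewrite big_split /= addnACA; apply: leq_add; last exact: IH.
have [Si|nSi] := pselect (S (a + i%:Z)); last by rewrite asboolF.
rewrite asboolT //.
have [gi|] := pselect (forall d : nat, (0 < d < K)%N -> ~ S (a + i%:Z + d%:Z)).
  by rewrite /good asboolT.
move=> /existsNP[d /not_implyP[/andP[d0 dK] /contrapT Sd]].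
rewrite (bigD1_seq d) ?iota_uniq ?mem_index_iota /= ?d0 ?dK //.
by rewrite asboolT //= addnCA leq_addr.
Qed.

Lemma sparse_shifts (S : set int) :
  (forall d : nat, (0 < d)%N -> sparse (returns S d)) ->
  sparse S.
Proof.
move=> sS M; have [->|M0] := posnP M; first by exists 0%N.
(* Elements without early return then number at most [L/(4M) + 1]. The [K - 1] return sets, each of
   density at most [1/(4MK)], add at most [L/(4M)], and [L >= 2M] absorbs the extra [1]. *)
pose K := (4 * M)%N.
have [L0 HL0] : exists L0 : nat, forall d, (0 < d < K)%N -> forall (a : int) (L : nat),
    (L0 <= L)%N -> a + L%:Z <= 1 ->
    ((4 * M * K) * card_window (returns S d) a L <= L)%N.
  (* The factor is generalized because [K] occurs in it and it must not shrink with the number of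
     shifts. *)
  elim: K (4 * M * K)%N => [|m IH] N; first by exists 0%N => d; lia.
  have [L1 HL1] := IH N; have [|m0] := posnP m.
    by move=> m0; exists 0%N => d; lia.
  have [L2 HL2] := sS m m0 N; exists (maxn L1 L2) => d dm a L; rewrite geq_max => /andP[le1 le2] aL.
  have [->|dm'] := eqVneq d m; first exact: HL2.
  by apply: HL1 => //; lia.
exists (maxn L0 (2 * M)) => a L; rewrite geq_max => /andP[L0L ML] aL.
have K0 : (0 < K)%N by rewrite /K; lia.
have := window_shifts S a L K0.
set w := card_window S a L; set sm := (\sum_(1 <= d < K) _)%N => w_le.
have sm_le : (4 * M * K * sm <= K * L)%N.
  rewrite big_distrr /= big_nat.
  apply: (@leq_trans (\sum_(1 <= d < K) L)%N).
    by rewrite [leqRHS]big_nat; apply: leq_sum => d dK; exact: HL0.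
  by rewrite sum_nat_const_nat leq_mul2r; lia.
have sm_le' : (4 * M * sm <= L)%N.
  by rewrite -(leq_pmul2l K0) mulnA (mulnC K).
have dv : (4 * M * (L %/ K) <= L)%N by rewrite mulnC; exact: leq_divM.
have : (4 * M * w <= 4 * M * ((L %/ K).+1 + sm))%N by rewrite leq_mul2l w_le orbT.
rewrite mulnDr mulnS; nia.
Qed.

(** Nonpositive integers above [n] have absolute value at most that of [n], which bounds their
    number independently of the window. *)
Lemma sparse_bounded (S : set int) (n : int) :
  (forall m, S m -> n < m) -> sparse S.
Proof.
move=> Sn M; exists (M * `|n|.+1)%N => a L ML aL.
apply: leq_trans ML; rewrite leq_mul2l; apply/orP; right.
rewrite /card_window -size_filter -(size_map (fun i : nat => absz (a + i%:Z)%R)).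
rewrite -[leqRHS](size_iota 0); apply: uniq_leq_size.
  rewrite map_inj_in_uniq ?filter_uniq ?iota_uniq // => i j.
  by rewrite !mem_filter !mem_iota => /andP[_ iL] /andP[_ jL]; lia.
move=> _ /mapP[i + ->]; rewrite mem_filter !mem_iota => /andP[/asboolP/Sn ? iL].
by lia.
Qed.

(** * Dynamics on noetherian spaces *)

(** Two nonempty open sets meet, as otherwise their complements would cover the irreducible
    space. *)
Lemma irreducible_meet (T : topologicalType) (G : nat -> set T) (d : nat) :
  irreducible T -> (forall i, (i < d)%N -> open (G i) /\ G i !=set0) ->
  exists2 O, open O /\ O !=set0 & forall i, (i < d)%N -> O `<=` G i.
Proof.
move=> [T0 irrT]; elim: d => [|d IH] HG; first by exists setT => //; split=> //; exact: openT.
have [|O [oO O0] OG] := IH; first by move=> i id; apply: HG; exact: ltnW.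
have [oG [y Gy]] := HG d (ltnSn d).
exists (O `&` G d).
  split; first exact: openI.
  apply: contrapT => /set0P/negP; rewrite negbK => /eqP OG0.
  have [|||/(congr1 setC)|/(congr1 setC)] := irrT (~` O) (~` G d).
  - exact: open_closedC.
  - exact: open_closedC.
  - by rewrite -setCI OG0 setC0.
  - by rewrite setCK setCT => O0'; case: O0 => z; rewrite O0'.
  - by rewrite setCK setCT => G0; move: Gy; rewrite G0.
move=> i; rewrite ltnS leq_eqVlt => /orP[/eqP-> z []//|/OG OGi z [/OGi]] //.
Qed.

Section Dynamics.
(** [pre O] abstracts the set of points where [f] is defined with value in [O]. The hypotheses on it
    record continuity, dominance, and that [f] moves the sequence one step with a single value. *)
Variables (T : topologicalType) (pre : set T -> set T) (x : int -> T).
Hypothesis T_noetherian : noetherian_set [set: T].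
Hypothesis T_irreducible : irreducible T.
Hypothesis pre_open : forall O, open O -> open (pre O).
Hypothesis pre_nonempty : forall O, open O -> O !=set0 -> pre O !=set0.
Hypothesis x_pre : forall (n : int) O, n <= -1 -> pre O (x n) <-> O (x (n + 1)).
Hypothesis x_dense : dense [set x n | n in [set n : int | n <= 0]].

Let visits (V : set T) : set int := [set n | n <= 0 /\ V (x n)].

Lemma iter_pre_open i O : open O -> open (iter i pre O).
Proof. by move=> oO; elim: i => //= i; exact: pre_open. Qed.

Lemma iter_pre_nonempty i O : open O -> O !=set0 -> iter i pre O !=set0.
Proof.
move=> oO O0; elim: i => //= i; apply: pre_nonempty; exact: iter_pre_open.
Qed.

Lemma x_iter_pre i (n : int) O : n + i%:Z <= 0 -> iter i pre O (x n) <-> O (x (n + i%:Z)).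
Proof.
elim: i n => [|i IH] n ni; first by rewrite addr0.
rewrite iterS x_pre; last by lia.
by rewrite IH; [rewrite (_ : n + 1 + i%:Z = n + i.+1%:Z) //; lia|lia].
Qed.

Lemma sparse_visits (V : set T) : closed V -> V <> setT -> sparse (visits V).
Proof.
move=> cV VT; apply: contrapT => nsV.
pose F := [set C : set T | [/\ closed C, C <> setT & ~ sparse (visits C)]].
have [||C [cC CT nsC] Cmin] := @noetherian_minimal T F T_noetherian.
- by move=> C [].
- by exists V.
have [d d0 nsd] : exists2 d : nat, (0 < d)%N & ~ sparse (returns (visits C) d).
  apply: contrapT => /forall2NP H; apply: nsC; apply: sparse_shifts => d d0.
  by have [|/contrapT] := H d.
have oC : open (~` C) by exact: closed_openC.
(* The points removed are those where [f^d] is defined with value outside [C]. Every [x n] that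
   returns to [C] after [d] steps remains, so minimality applies. *)
have C_inv : C `&` ~` iter d pre (~` C) = C.
  apply: Cmin; last exact: subIsetl.
  split.
  - by apply: closedI => //; apply: open_closedC; exact: iter_pre_open.
  - by move=> H; apply: CT; apply/seteqP; split=> // y _; have : [set: T] y by []; rewrite -H => -[].
  apply: contra_not nsd; apply: sparse_sub => n [[n0 Cn] [nd0 Cnd]]; split=> //; split=> //.
  by move=> /x_iter_pre; apply.
(* For all [i < d] at once, [f^(d - i)] sends [G] outside [C]; this open set replaces a discussion
   of which image of [C] is dense. *)
have [G [oG G0] Opre] : exists2 G, open G /\ G !=set0 &
    forall i, (i < d)%N -> G `<=` iter (d - i) pre (~` C).
  apply: irreducible_meet => // i _; split; first exact: iter_pre_open.
  apply: iter_pre_nonempty => //; apply: contrapT => /set0P/negP; rewrite negbK => /eqP C0.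
  by apply: CT; rewrite -[C]setCK C0 setC0.
have [y [Gy [n /= n0 xn]]] := x_dense G0 oG.
have [m [m0 Cm] mn] : exists2 m, visits C m & (m <= n)%R.
  apply: contrapT => /forall2NP H; apply: nsC; apply: (@sparse_bounded _ n) => m Sm.
  by rewrite ltNge; apply/negP => mn; case: (H m).
have Cdq q : m + (d * q)%:Z <= 0 -> C (x (m + (d * q)%:Z)).
  elim: q => [|q IH] q0; first by rewrite muln0 addr0.
  have /IH : (m + (d * q)%:Z <= 0)%R by nia.
  rewrite -{1}C_inv => -[_ nC]; apply: contrapT => nCq; apply: nC.
  apply/x_iter_pre; first by nia.
  by rewrite (_ : _ + d%:Z = m + (d * q.+1)%:Z) //; lia.
(* Division by [d] places [x n] fewer than [d] steps after a visit to [C], at time [m + d * q]. *)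
pose e := `|n - m|%N; have nE : n = m + (d * (e %/ d))%:Z + (e %% d)%:Z.
  by have := divn_eq e d; rewrite /e; lia.
have i_d : (e %% d < d)%N by rewrite ltn_mod.
move: nE i_d Gy; rewrite -xn; move: (e %% d)%N (e %/ d)%N => i q nE i_d.
move=> /(Opre i i_d) Hn.
have : C (x (m + (d * q)%:Z)) by apply: Cdq; lia.
rewrite -C_inv => -[_]; apply.
(* The sequence is followed only for the [i] steps up to time [n]; the other [d - i] steps may pass
   time [0] and are taken in the space. *)
have -> : iter d pre (~` C) = iter i pre (iter (d - i) pre (~` C)).
  by rewrite -iterD subnKC // ltnW.
by apply/x_iter_pre; rewrite -nE.
Qed.

End Dynamics.

(** * Application to rational self-maps of varieties *)

Theorem theorem1p17 (R : realType) (k : closedFieldType) (X : kspace k)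
    (hX : is_variety X) (f : rational_map X X) (hf : dominant f)
    (x : int -> X)
    (x_rational : forall n : int, n <= 0 -> rational_point (x n))
    (x_orbit : forall n : int, n <= 0 -> orbit_defined f (x n))
    (x_dense : dense [set x n | n in [set n : int | n <= 0]])
    (x_step : forall n : int, n <= -1 -> rat_value f (x n) (x (n + 1)))
    (V : set X) (V_closed : closed V) (V_proper : V <> setT) :
  banach_density_zero R [set n : int | n <= 0 /\ V (x n)].
Proof.
case: hX => schX irrX _ sepX finX; apply: sparse_banach.
pose pre (O : set X) := [set y | exists2 z, rat_value f y z & O z].
apply: (@sparse_visits X pre x) => //.
- exact: finite_type_noetherian.
- move=> O oO.
  have -> : pre O = \bigcup_(r in rat_class f) (dom r `&` r @^-1` O).
    apply/seteqP; split=> [y [_ [r [fr ry <-]] Ory]|y [r fr [ry Ory]]]; first by exists r.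
    by exists (r y) => //; exists r.
  by apply: bigcup_open => r _; exact: mor_cont.
- move=> O oO O0; have [r fr r_dense] := hf.
  have [z [Oz [y ry ryz]]] := r_dense _ O0 oO.
  by exists y; exists z => //; exists r.
- move=> n O n1; split=> [[z xz Oz]|Ox]; last by exists (x (n + 1)) => //; exact: x_step.
  by rewrite (rat_value_unique schX sepX (x_step n n1) xz).
Qed.
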